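(* Let $\lambda$ be a Young diagram and let $X=\{X_{i,j}\colon (i,j)\in\lambda\}$ be a random tableau of shape $\lambda$ whose entries are either i.i.d. geometric random variables or i.i.d. exponential random variables. Define, for $(i,j)\in\lambda$, the LPP tableau $L_{i,j}=L(1,1;i,j)$ and the dual LPP tableau $L^*_{i,j}=L(i,1;1,j)$, where $L(a,b;c,d)=\max_{\pi}\sum_{(p,q)\in\pi}X_{p,q}$ with the maximum over directed lattice paths $\pi$ from $(a,b)$ to $(c,d)$. Let $\mathcal{B}$ be the border strip of $\lambda$. Then $(L_{i,j})_{(i,j)\in\mathcal{B}}$ and $(L^*_{i,j})_{(i,j)\in\mathcal{B}}$ have the same joint distribution. In particular, the corner entries of $L$ and $L^*$ have the same joint distribution.
   Context: Boxes of a Young diagram are identified with $(i,j)\in\mathbb{N}^2$ ($i$ = row index, $j$ = column index). A tableau of shape $\lambda$ is an array of non-negative reals indexed by the boxes of $\lambda$. A directed lattice path from $(a,b)$ to $(c,d)$ is a sequence $((i_k,j_k))_{k=0}^m$ of minimal length $m=|c-a|+|d-b|$ with $(i_0,j_0)=(a,b)$, $(i_m,j_m)=(c,d)$ and $|i_{k+1}-i_k|+|j_{k+1}-j_k|=1$ (for $(i,j)\in\lambda$ all such paths between $(1,1)$ and $(i,j)$, or between $(i,1)$ and $(1,j)$, stay in $\lambda$). A box $(i,j)\in\lambda$ is a border box if $(i+1,j+1)\notin\lambda$; the border strip is the set of border boxes. A box is a corner if removing it from $\lambda$ leaves a Young diagram. Geometric means $\mathbb{P}(X_{i,j}=m)=p(1-p)^m$,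 $m\ge0$, for some $p\in(0,1)$; exponential means of some rate $\alpha>0$. *)

(* Defs.v *)
From HB Require Import structures.
From mathcomp Require Import all_boot all_order all_algebra finmap zify.
From mathcomp Require Import all_classical all_reals all_analysis.

Set Implicit Arguments.
Unset Strict Implicit.
Unset Printing Implicit Defensive.

Import Order.TTheory GRing.Theory Num.Theory.

Local Open Scope classical_set_scope.
Local Open Scope ring_scope.

(* Boxes are pairs (row, column), both numbered from 1. *)
Definition young (la : {fset nat * nat}) : Prop :=
  forall i j, (i, j) \in la ->
    [/\ (0 < i)%N, (0 < j)%N &
        forall i' j', (0 < i' <= i)%N -> (0 < j' <= j)%N -> (i', j') \in la].

Definition border (la : {fset nat * nat}) : {set la} :=
  [set b : la | ((val b).1.+1, (val b).2.+1) \notin la]%SET.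

Definition corners (la : {fset nat * nat}) : {set la} :=
  [set b : la | `[< young (la `\ val b)%fset >]]%SET.

Definition box_dist (a c : nat * nat) : nat :=
  (`|a.1 - c.1| + `|a.2 - c.2|)%N.

Definition lattice_path (a c : nat * nat) (pi : seq (nat * nat)) : bool :=
  if pi is q :: s then
    [&& q == a, path (fun u v => box_dist u v == 1%N) q s, last q s == c &
        size s == box_dist a c]
  else false.

Lemma lattice_path_dist a c pi q : lattice_path a c pi -> q \in pi ->
  (box_dist a q + box_dist q c)%N = box_dist a c.
Proof.
have pathE u s : path (fun u v => box_dist u v == 1%N) u s ->
    (box_dist u (last u s) <= size s)%N.
  elim: s u => [u _|v s IHs u /= /andP[/eqP uv /IHs]].
    by rewrite /box_dist /= !distnn.
  by move: uv; rewrite /box_dist; lia.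
case: pi => [//|u s] /and4P[/eqP -> ps /eqP lastc /eqP sizes].
move=> qs; case/splitPl: qs ps lastc sizes => s1 s2 last1.
rewrite cat_path last_cat size_cat last1.
move=> /andP[/pathE]; rewrite last1 => d1 /pathE + lc; rewrite lc => d2.
by move: d1 d2; rewrite /box_dist; lia.
Qed.

Lemma lattice_path_young1 la i j pi : young la -> (i, j) \in la ->
  lattice_path (1%N, 1%N) (i, j) pi -> {subset pi <= la}.
Proof.
move=> yla ijla pi_path [k l] /(lattice_path_dist pi_path).
have [i0 j0 sub] := yla _ _ ijla.
by rewrite /box_dist /= => dE; apply: sub; lia.
Qed.

Lemma lattice_path_young2 la i j pi : young la -> (i, j) \in la ->
  lattice_path (i, 1%N) (1%N, j) pi -> {subset pi <= la}.
Proof.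
move=> yla ijla pi_path [k l] /(lattice_path_dist pi_path).
have [i0 j0 sub] := yla _ _ ijla.
by rewrite /box_dist /= => dE; apply: sub; lia.
Qed.

Lemma lattice_path_exists a c : exists pi, lattice_path a c pi.
Proof.
move nE: (box_dist a c) => n; elim: n a nE => [|n IHn] a nE.
  have -> : a = c.
    by case: a c nE => [a1 a2] [c1 c2]; rewrite /box_dist /= => ?; congr pair; lia.
  by exists [:: c]; rewrite /= /box_dist !distnn !eqxx.
have [b ab bc] : exists2 b, box_dist a b = 1%N & box_dist b c = n.
  case: a c nE {IHn} => [a1 a2] [c1 c2]; rewrite /box_dist /= => ?.
  have [?|?|?] := ltngtP a1 c1.
  - by exists (a1.+1, a2) => /=; lia.
  - by exists (a1.-1, a2) => /=; lia.
  have [?|?] := ltnP a2 c2.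
  - by exists (a1, a2.+1) => /=; lia.
  - by exists (a1, a2.-1) => /=; lia.
have [] := IHn b; first by rewrite bc.
case=> [//|q s] /and4P[/eqP -> ps ls /eqP ss].
by exists [:: a, b & s]; rewrite /= ab ps ls ss nE bc !eqxx.
Qed.

Section LastPassage.
Context {R : realType} {la : {fset nat * nat}}.
Implicit Types (x : la -> R) (a c : nat * nat) (b : la).

(* The lattice paths from a to c, as sequences of boxes of la. This is no loss
   for the endpoints used below: see lattice_path_young1, lattice_path_young2. *)
Definition lattice_paths a c : seq ((box_dist a c).+1.-tuple la) :=
  enum [pred pi : (box_dist a c).+1.-tuple la | lattice_path a c (map val pi)].

Definition path_weights x a c : seq R :=
  [seq \sum_(q <- tval pi) x q | pi <- lattice_paths a c].

(* Starting the iterated maximum from a member of the list makes it the true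
   maximum, without assuming that the weights are nonnegative. *)
Definition lpp x a c : R :=
  \big[Num.max/head 0 (path_weights x a c)]_(y <- path_weights x a c) y.

Definition lpp_tableau x b : R := lpp x (1%N, 1%N) (val b).

Definition dual_lpp_tableau x b : R :=
  lpp x ((val b).1, 1%N) (1%N, (val b).2).

Lemma lpp_ge x a c pi : pi \in lattice_paths a c ->
  \sum_(q <- tval pi) x q <= lpp x a c.
Proof. by move=> pi_in; apply: le_bigmax_seq => //; apply: map_f. Qed.

Lemma lpp_attained x a c : (forall pi, lattice_path a c pi -> {subset pi <= la}) ->
  exists2 pi, pi \in lattice_paths a c & lpp x a c = \sum_(q <- tval pi) x q.
Proof.
move=> sub; suff /mapP[pi ? ?] : lpp x a c \in path_weights x a c by exists pi.
have [pi pi_path] := lattice_path_exists a c.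
have szpi : size (pmap insub pi : seq la) == (box_dist a c).+1.
  rewrite size_pmap_sub; have /eqP -> : count [in la] pi == size pi.
    by rewrite -all_count; apply/allP => q /(sub _ pi_path).
  by case: pi pi_path {sub} => [//|q s] /and4P[_ _ _ /eqP /= ->].
have : Tuple szpi \in lattice_paths a c.
  rewrite mem_enum inE /= pmap_filter; last exact: insubK.
  rewrite (eq_in_filter (a2 := predT)) ?filter_predT // => q /(sub _ pi_path) qla.
  by rewrite /= insubT.
move/(map_f (fun pi : (box_dist a c).+1.-tuple la => \sum_(q <- tval pi) x q)).
rewrite /lpp -/(path_weights x a c).
case: (path_weights x a c) => [//|w ws] _ /=.
rewrite big_seq; elim/big_ind: _ => [|u v|//]; first exact: mem_head.
by rewrite /Num.max; case: ifP.
Qed.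

End LastPassage.

Section Probability.
Context {R : realType} {d : measure_display} {T : measurableType d}.
Variable P : probability T R.

Definition mutually_independent (I : finType) (X : I -> {RV P >-> R}) : Prop :=
  forall (J : {set I}) (A : I -> set R), (forall i, measurable (A i)) ->
    P (\bigcap_(i in [set` J]) (X i @^-1` A i)) =
    (\prod_(i in J) P (X i @^-1` A i))%E.

Definition geometric_law (p : R) (X : {RV P >-> R}) : Prop :=
  forall m : nat, P (X @^-1` [set m%:R]) = (p * (1 - p) ^+ m)%:E.

Definition exponential_law (alpha : R) (X : {RV P >-> R}) : Prop :=
  forall A : set R, measurable A ->
    distribution P X A = exponential_prob alpha A.

Definition joint (I : finType) (S : {set I}) (Y : I -> T -> R) (w : T) :
    #|S|.-tuple R :=
  [tuple Y (enum_val i) w | i < #|S|].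

(* The laws are compared on measurable sets only, because the value of a
   measure on other sets is unconstrained. *)
Definition same_joint_law (I : finType) (S : {set I}) (Y Z : I -> T -> R) :
    Prop :=
  forall A : set (#|S|.-tuple R), measurable A ->
    pushforward P (joint S Y) A = pushforward P (joint S Z) A.

End Probability.

(* Main.v *)
(* Attach a partition to every vertex of the cell grid, zero on the axes, by a
   local rule computing the partition at the far corner of a cell from the three
   others and the entry of the cell.  With the RSK rule the largest part at
   (i, j) is L(1,1;i,j); with the Burge rule it is L(i,1;1,j).  Both rules are
   invertible, so either diagram is an arbitrary interlacing family of partitions
   along the border; reading the Burge diagram of a tableau as an RSK diagram
   defines a bijection of the integer tableaux of shape la turning dual passage
   times at the border into ordinary ones.  It preserves the sum of the entries,
   because the sums of the rows are differences of sizes of border partitions.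
   Hence it preserves the i.i.d. geometric measure.  Exponential entries rounded
   to a lattice of mesh k are geometric and move passage times by O(k), and k is
   sent to 0.

   The Burge diagram computes L(i,1;1,j) since its rule, one part at a time, is a
   move on two consecutive rows that leaves invariant the passage times through
   these rows from arbitrary initial values; it turns the rows of the tableau into
   the lines formed by the k-th parts, which interlace. *)
Require Import Defs.
From HB Require Import structures.
From mathcomp Require Import all_boot all_order all_algebra finmap zify lra.
From mathcomp Require Import all_classical all_reals all_analysis measurable_realfun.

Set Implicit Arguments.
Unset Strict Implicit.
Unset Printing Implicit Defensive.

Import Order.TTheory GRing.Theory Num.Theory.

(** * Local rules *)

(* A partition is the sequence of its parts, padded with zeros. *)
Notation part := (nat -> nat).

(** The skew shape n/m is a horizontal strip. Parts are numbered from 0. *)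
Definition interlace (m n : part) := forall k, (m k <= n k) && (n k.+1 <= m k).
Definition parts_le K (m : part) := forall k, K <= k -> m k = 0.

Lemma interlace_parts K m n : interlace m n -> parts_le K n -> parts_le K m.
Proof. by move=> mn nK k kK; move: (mn k); rewrite nK //; lia. Qed.

(* In a cell with partitions m, n, r at its vertices (i, j), (i, j+1), (i+1, j) and
   entry x, [fwd i m n r x] is the partition at (i+1, j+1); [bwd] and [inp]
   recover m and x from it. *)
Record local_rule := LocalRule {
  fwd : nat -> part -> part -> part -> nat -> part;
  bwd : nat -> part -> part -> part -> part;
  inp : nat -> part -> part -> part -> nat }.

(** For fixed [n] and [r], [fwdP] and [bwdP] say that (m, x) and p determine each other. [K] bounds
    the number of parts of [n]: Burge insertion starts at part [K], and the sums in [sumP] see all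
    parts. *)
Record rule_ok (F : local_rule) : Prop := RuleOk {
  fwdP : forall K m n r x, interlace m n -> interlace m r -> parts_le K n -> parts_le K.+1 r ->
    [/\ interlace n (fwd F K m n r x), interlace r (fwd F K m n r x),
        parts_le K.+1 (fwd F K m n r x), bwd F K (fwd F K m n r x) n r = m &
        inp F K (fwd F K m n r x) n r = x];
  bwdP : forall K p n r, interlace n p -> interlace r p -> parts_le K n -> parts_le K.+1 r ->
    parts_le K.+1 p ->
    [/\ interlace (bwd F K p n r) n, interlace (bwd F K p n r) r &
        fwd F K (bwd F K p n r) n r (inp F K p n r) = p];
  sumP : forall K m n r x, interlace m n -> interlace m r -> parts_le K n -> parts_le K.+1 r ->
    \sum_(k < K.+1) fwd F K m n r x k + \sum_(k < K.+1) m k =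
    \sum_(k < K.+1) n k + \sum_(k < K.+1) r k + x }.

(** Fomin's local rule for RSK, in piecewise linear form. *)
Definition rsk_rule := LocalRule
  (fun _ m n r x k => maxn (n k) (r k) +
     (if k is k'.+1 then minn (n k') (r k') - m k' else x))
  (fun _ p n r k => minn (n k) (r k) - (p k.+1 - maxn (n k.+1) (r k.+1)))
  (fun _ p n r => p 0 - maxn (n 0) (r 0)).

Lemma rsk_rule_ok : rule_ok rsk_rule.
Proof.
split => [K m n r x mn mr nK rK|K p n r np rp nK rK pK|K m n r x mn mr nK rK] /=.
- split.
  + case=> [|k] /=; first by move: (mn 0) (mr 0); lia.
    by move: (mn k) (mr k) (mn k.+1) (mr k.+1); lia.
  + case=> [|k] /=; first by move: (mn 0) (mr 0); lia.
    by move: (mn k) (mr k) (mn k.+1) (mr k.+1); lia.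
  + case=> [//|k] kK /=; rewrite rK // nK ?(nK k) //; lia.
  + by apply: funext => k /=; move: (mn k) (mr k); lia.
  + by rewrite addKn.
- split.
  + by move=> k /=; move: (np k) (rp k) (np k.+1) (rp k.+1); lia.
  + by move=> k /=; move: (np k) (rp k) (np k.+1) (rp k.+1); lia.
  + apply: funext => -[|k] /=; first by move: (np 0) (rp 0); lia.
    by move: (np k) (rp k) (np k.+1) (rp k.+1); lia.
- have mK := interlace_parts mn nK.
  pose p := fwd rsk_rule K m n r x.
  (* Maximum and minimum of two parts add up to their sum, so only the minimum of the parts [J] is
     left over; it vanishes at [J = K]. *)
  have sumJ J : \sum_(k < J.+1) p k + \sum_(k < J) m k + minn (n J) (r J) =
      \sum_(k < J.+1) n k + \sum_(k < J.+1) r k + x.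
    elim: J => [|J IHJ]; first by rewrite !big_ord1 big_ord0 /p /=; lia.
    rewrite ![\sum_(k < J.+2) _]big_ord_recr [\sum_(k < J.+1) m k]big_ord_recr.
    have : p J.+1 = maxn (n J.+1) (r J.+1) + (minn (n J) (r J) - m J) by [].
    by move: IHJ (mn J) (mr J) => /=; lia.
  have := sumJ K; rewrite nK // min0n addn0 => <-.
  by rewrite [\sum_(k < K.+1) m k]big_ord_recr /= mK // addn0.
Qed.

(* In the Burge rule x is inserted into the last part: each part takes as much of
   the incoming amount as interlacing allows and passes the rest, together with
   its own increment from m to n, to the previous part.  [rise d] is the amount
   that leaves the last d of K parts, [descend k] the same amount entering part k
   recovered from the result. *)
Fixpoint rise (m n r : part) K x d :=
  if d is d'.+1 then
    rise m n r K x d' + (n (K - d) - m (K - d)) -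
      minn (rise m n r K x d') (m (K - d) - r (K - d).+1)
  else x.

Fixpoint descend (p n r : part) k :=
  if k is k'.+1 then
    descend p n r k' + (p k - r k) - minn (descend p n r k') (n k' - p k)
  else p 0 - r 0.

Definition burge_rule := LocalRule
  (fun K m n r x k => r k + (if k is k'.+1
     then minn (rise m n r K x (K - k)) (m k' - r k) else rise m n r K x K))
  (fun _ p n r k => n k - minn (descend p n r k) (n k - p k.+1))
  (fun K p n r => descend p n r K).

Lemma riseE m n r K x k : k < K -> rise m n r K x (K - k) =
  rise m n r K x (K - k.+1) + (n k - m k) -
    minn (rise m n r K x (K - k.+1)) (m k - r k.+1).
Proof.
move=> kK; have -> : K - k = (K - k.+1).+1 by lia.
by rewrite /= (_ : K - (K - k.+1).+1 = k) //; lia.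
Qed.

Lemma burge_rule_ok : rule_ok burge_rule.
Proof.
split => [K m n r x mn mr nK rK|K p n r np rp nK rK pK|K m n r x mn mr nK rK].
- have mK := interlace_parts mn nK.
  set p := fwd _ _ _ _ _ _.
  have pS k : p k.+1 = r k.+1 + minn (rise m n r K x (K - k.+1)) (m k - r k.+1) by [].
  have p0 : p 0 = r 0 + rise m n r K x K by [].
  (* Both sides are the amount entering part k. Either part k+1 absorbs all that enters it, or it
     reaches [m k]; in both cases [n k - m k] is the minimum of the amount entering part k and
     [n k - p k.+1]. *)
  have dE k : k <= K -> descend p n r k = rise m n r K x (K - k).
    elim: k => [|k IHk] kK; first by rewrite /= p0 subn0; lia.
    rewrite /= IHk 1?ltnW // riseE // pS.
    by move: (mn k) (mr k); lia.
  split.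
  + move=> k; have [kK|Kk] := ltnP k K; last first.
      rewrite nK // pS; have := mr k; rewrite mK //; lia.
    apply/andP; split; last by rewrite pS; move: (mn k) (mr k); lia.
    case: k kK => [|k] kK.
      by have := riseE m n r x kK; rewrite p0 subn0; move: (mn 0) (mr 0); lia.
    have := riseE m n r x kK; rewrite pS.
    by move: (mn k) (mr k) (mn k.+1) (mr k.+1); lia.
  + move=> k; apply/andP; split; last by rewrite pS; move: (mn k) (mr k); lia.
    by case: k => [|k]; rewrite ?p0 ?pS leq_addr.
  + by case=> [//|k] kK; rewrite pS rK // mK // minn0.
  + apply: funext => k /=; have [kK|Kk] := leqP K k; first by rewrite nK // mK.
    rewrite dE ?(ltnW Kk) // riseE // pS.
    by move: (mn k) (mr k); lia.
  + by rewrite /= dE // subnn.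
- set m := bwd _ _ _ _ _; set x := descend p n r K.
  have mE k : m k = n k - minn (descend p n r k) (n k - p k.+1) by [].
  have dS k : descend p n r k.+1 = descend p n r k + (p k.+1 - r k.+1) -
     minn (descend p n r k) (n k - p k.+1) by [].
  have dE d : d <= K -> rise m n r K x d = descend p n r (K - d).
    elim: d => [|d IHd] dK; first by rewrite /= subn0.
    rewrite /= IHd 1?ltnW //.
    have -> : K - d = (K - d.+1).+1 by lia.
    rewrite dS mE.
    set k := K - d.+1; move: (np k) (rp k) (rp k.+1); lia.
  split.
  + by move=> k; rewrite mE; move: (np k) (np k.+1); lia.
  + move=> k; rewrite mE; apply/andP; split; last by move: (np k) (rp k) (rp k.+1) (np k.+1); lia.
    case: k => [|k]; first by rewrite /=; move: (np 0) (rp 0); lia.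
    by rewrite dS; move: (np k) (rp k) (np k.+1) (rp k.+1); lia.
  + apply: funext => -[|k] /=; rewrite -/m -/x.
      by rewrite dE // subnn /=; move: (rp 0); lia.
    have [kK|Kk] := ltnP k K.
      rewrite dE ?leq_subr // subKn // dS mE.
      by move: (np k) (rp k) (np k.+1) (rp k.+1); lia.
    by rewrite rK // mE nK // sub0n minn0 pK.
- have mK := interlace_parts mn nK.
  pose p := fwd burge_rule K m n r x; set c := rise m n r K x.
  have p0 : p 0 = r 0 + c K by [].
  (* The first parts balance up to the amount entering part [J], which is [x] when [J = K]. *)
  have sumJ J : J <= K -> \sum_(k < J.+1) p k + \sum_(k < J) m k =
      \sum_(k < J.+1) r k + \sum_(k < J) n k + c (K - J).
    elim: J => [|J IHJ] JK; first by rewrite !big_ord1 !big_ord0 subn0 /= p0; lia.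
    rewrite ![\sum_(k < J.+2) _]big_ord_recr [\sum_(k < J.+1) m k]big_ord_recr.
    rewrite [\sum_(k < J.+1) n k]big_ord_recr.
    have : p J.+1 = r J.+1 + minn (c (K - J.+1)) (m J - r J.+1) by [].
    have := riseE m n r x JK; rewrite -/c.
    by move: (IHJ (ltnW JK)) (mn J) (mr J) => /=; lia.
  have := sumJ K (leqnn K); rewrite subnn.
  rewrite [\sum_(k < K.+1) m k]big_ord_recr [\sum_(k < K.+1) n k]big_ord_recr.
  by rewrite [m ord_max]mK // [n ord_max]nK // -/p /c /=; lia.
Qed.

(** * Growth diagrams *)

Section Growth.
Variable F : local_rule.

(** The inner fixpoint runs along a row, so that both recursions are structural. The rule receives
    [i'], the bound on the number of parts in the previous row. *)
Fixpoint growth (x : nat -> nat -> nat) i : nat -> part :=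
  if i is i'.+1 then
    fix row j := if j is j'.+1
      then fwd F i' (growth x i' j') (growth x i' j) (row j') (x i j)
      else fun=> 0
  else fun _ _ => 0.

#[local] Arguments growth : simpl never.

Lemma growthSS x i j : growth x i.+1 j.+1 =
  fwd F i (growth x i j) (growth x i j.+1) (growth x i.+1 j) (x i.+1 j.+1).
Proof. by []. Qed.

Lemma growth0 x i : growth x i 0 = fun=> 0.
Proof. by case: i. Qed.

(** These constraints do not mention the rule, so a diagram of one rule can be handed to another.
    Row 0 is empty by the third one. *)
Definition growth_data (g : nat -> nat -> part) :=
  [/\ forall i j, interlace (g i j) (g i.+1 j), forall i j, interlace (g i j) (g i j.+1),
      forall i j, parts_le i (g i j) & forall i, parts_le 0 (g i 0)].

Hypothesis F_ok : rule_ok F.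

Lemma growthP x : growth_data (growth x).
Proof.
have row i : (forall j, parts_le i (growth x i j) /\ interlace (growth x i j) (growth x i j.+1)) ->
    forall j, [/\ parts_le i.+1 (growth x i.+1 j), interlace (growth x i j) (growth x i.+1 j)
      & interlace (growth x i.+1 j) (growth x i.+1 j.+1)].
  move=> IHi.
  have vert j : parts_le i.+1 (growth x i.+1 j) /\ interlace (growth x i j) (growth x i.+1 j).
    elim: j => [|j [IHs IHv]]; first by rewrite !growth0; split=> // k.
    rewrite growthSS.
    by have [] := fwdP F_ok (x i.+1 j.+1) (IHi j).2 IHv (IHi j.+1).1 IHs.
  move=> j; have [sj vj] := vert j; split=> //; rewrite growthSS.
  by have [] := fwdP F_ok (x i.+1 j.+1) (IHi j).2 vj (IHi j.+1).1 sj.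
have all_rows i j : parts_le i (growth x i j) /\ interlace (growth x i j) (growth x i j.+1).
  elim: i j => [|i IHi] j; first by split=> // k.
  by have [] := row i IHi j.
split=> [i j|i j|i j|i]; [by have [] := row i (all_rows i) j|..].
- exact: (all_rows i j).2.
- exact: (all_rows i j).1.
- by rewrite growth0.
Qed.

(** [sumP] telescopes along the row. *)
Lemma growth_row_sum x i n :
  \sum_(j < n) x i.+1 j.+1 + \sum_(k < i.+1) growth x i n k =
  \sum_(k < i.+1) growth x i.+1 n k.
Proof.
have [v h s _] := growthP x.
elim: n => [|n IHn]; first by rewrite big_ord0 !growth0.
have := sumP F_ok (x i.+1 n.+1) (h i n) (v i n) (s i n.+1) (s i.+1 n).
by rewrite [\sum_(j < n.+1) _]big_ord_recr -growthSS -IHn /=; lia.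
Qed.

Variables (D : nat -> nat -> bool) (N : nat).
Hypothesis D_pos : forall i j, D i j -> (0 < i) && (0 < j).
Hypothesis D_down : forall i j i' j', D i j -> 0 < i' <= i -> 0 < j' <= j -> D i' j'.
Hypothesis D_bound : forall i j, D i j -> i + j < N.

(* The vertices of the cells of D, the cell (i, j) having (i, j) as its corner
   of largest coordinates. *)
Definition vertex i j := [|| i == 0, j == 0 | D i j].

(** [g] is kept at the vertices that are not the near corner of a cell; the others are recomputed
    from the border inwards. [f] is fuel: each call raises i + j, which stays below [N] on cells, so
    [N] is enough. *)
Fixpoint fill (g : nat -> nat -> part) f i j : part :=
  if f is f'.+1 then
    if D i.+1 j.+1
    then bwd F i (fill g f' i.+1 j.+1) (fill g f' i j.+1) (fill g f' i.+1 j)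
    else g i j
  else g i j.

Lemma fill_stable g f f' i j : N <= f + i + j -> N <= f' + i + j ->
  fill g f i j = fill g f' i j.
Proof.
elim: f f' i j => [|f IHf] [|f'] i j //= Nf Nf'; case: ifP => [/D_bound|]; try by [lia|].
by move=> _; congr bwd; apply: IHf; lia.
Qed.

Lemma fillE g i j : fill g N i j = if D i.+1 j.+1 then
    bwd F i (fill g N i.+1 j.+1) (fill g N i j.+1) (fill g N i.+1 j)
  else g i j.
Proof.
rewrite [LHS](@fill_stable _ _ N.+1) /=; [|lia..].
by [].
Qed.

Lemma vertex_cell i j : D i.+1 j.+1 -> vertex i.+1 j /\ vertex i j.+1.
Proof.
move=> Dij; rewrite /vertex; split.
  by case: j Dij => //= j Dij; apply: D_down Dij _ _; lia.
by case: i Dij => //= i Dij; apply: D_down Dij _ _; lia.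
Qed.

Lemma eq_fill g g' f i j :
  (forall a b, vertex a b -> ~~ D a.+1 b.+1 -> g a b = g' a b) ->
  N <= f + i + j -> vertex i j -> fill g f i j = fill g' f i j.
Proof.
move=> gg'; elim: f i j => [|f IHf] i j /= Nf vij.
  by apply: gg' => //; apply/negP => /D_bound; lia.
case: ifP => [Dij|/negbT]; last exact: gg'.
have [? ?] := vertex_cell Dij.
by rewrite !IHf //; try lia; rewrite /vertex Dij orbT.
Qed.

Lemma eq_growth x y i j : (forall a b, D a b -> x a b = y a b) -> vertex i j ->
  growth x i j = growth y i j.
Proof.
move=> xy; elim: i j => [//|i IHi]; elim=> [|j IHj]; first by rewrite !growth0.
move=> vij; have {vij}Dij : D i.+1 j.+1 by [].
have [? ?] := vertex_cell Dij.
have vij : vertex i j.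
  rewrite /vertex; case: (i) (j) Dij => [//|a] [//|b] Dab /=.
  by apply: D_down Dab _ _; lia.
by rewrite !growthSS !IHi // IHj // xy.
Qed.

Lemma fillP g : growth_data g -> growth_data (fill g N).
Proof.
move=> [gv gh gs g0].
(* Descending induction on i + j, starting beyond [N] where [fill] is [g]. The last clause carries
   the condition on column 0. *)
pose P i j := [/\ interlace (fill g N i j) (fill g N i.+1 j),
  interlace (fill g N i j) (fill g N i j.+1), parts_le i (fill g N i j) &
  j = 0 -> parts_le 0 (fill g N i 0)].
suff all_P d i j : N <= d + i + j -> P i j.
  have {}all_P i j : P i j by apply: (all_P N); lia.
  split=> [i j|i j|i j|i]; try by have [] := all_P i j.
  by have [_ _ _ c] := all_P i 0; exact: c.
elim: d i j => [|d IHd] i j Nd.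
  have out a b : N <= a + b -> fill g N a b = g a b.
    by move=> ?; rewrite fillE ifN //; apply/negP => /D_bound; lia.
  rewrite /P (out i j) 1?(out i.+1 j) 1?(out i j.+1); try lia.
  split=> // j0; rewrite out; last by lia.
    exact: g0.
have [Dij|nDij] := boolP (D i.+1 j.+1); last first.
  have out a b : ~~ D a.+1 b.+1 -> fill g N a b = g a b by move=> nD; rewrite fillE ifN.
  rewrite /P (out i j) //; rewrite (out i.+1 j); last first.
    by apply: contra nDij => Dij; apply: D_down Dij _ _; lia.
  rewrite (out i j.+1); last first.
    by apply: contra nDij => Dij; apply: D_down Dij _ _; lia.
  by split=> // j0; rewrite j0 in nDij; rewrite out.
have [v1 h1 s1 c1] := IHd i.+1 j ltac:(lia).
have [v2 h2 s2 _] := IHd i j.+1 ltac:(lia).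
have [v3 h3 s3 _] := IHd i.+1 j.+1 ltac:(lia).
have [hm vm _] := bwdP F_ok v2 h1 s2 s1 s3.
have fE : fill g N i j = bwd F i (fill g N i.+1 j.+1) (fill g N i j.+1) (fill g N i.+1 j).
  by rewrite fillE Dij.
rewrite /P fE; split => //; first exact: interlace_parts hm s2.
by move=> j0; subst j; rewrite fE; apply: interlace_parts vm (c1 _).
Qed.

Definition decode g i j :=
  inp F i.-1 (fill g N i j) (fill g N i.-1 j) (fill g N i j.-1).

(** Every admissible border thus comes from a tableau: by [bwdP], cell by cell, the decoded entry
    reproduces the filled partition. *)
Lemma growth_decode g i j : growth_data g -> vertex i j ->
  growth (decode g) i j = fill g N i j.
Proof.
move=> g_data; have [v h s c] := fillP g_data.
elim: i j => [|i IHi] j; first by move=> _; apply: funext => k; rewrite s.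
elim: j => [|j IHj]; first by move=> _; rewrite growth0; apply: funext => k; rewrite c.
move=> Dij; have {}Dij : D i.+1 j.+1 by []; have [? ?] := vertex_cell Dij.
have vij : vertex i j.
  rewrite /vertex; case: (i) (j) Dij => [//|a] [//|b] Dab /=.
  by apply: D_down Dab _ _; lia.
rewrite growthSS !IHi // IHj // /decode /= (fillE g i j) Dij.
by have [_ _ ->] := bwdP F_ok (v i j.+1) (h i.+1 j) (s i j.+1) (s i.+1 j) (s i.+1 j.+1).
Qed.

Lemma fill_growth x i j : fill (growth x) N i j = growth x i j.
Proof.
have [v h s _] := growthP x.
suff all_d d a b : N <= d + a + b -> fill (growth x) N a b = growth x a b.
  by apply: (all_d N); lia.
elim: d a b => [|d IHd] a b Nd; rewrite fillE; case: ifP => // Dab.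
  by have := D_bound Dab; lia.
rewrite !IHd; [|lia..]; rewrite growthSS.
by have [] := fwdP F_ok (x a.+1 b.+1) (h a b) (v a b) (s a b.+1) (s a.+1 b).
Qed.

Lemma decode_growth x i j : D i j -> decode (growth x) i j = x i j.
Proof.
case: i j => [|i] [|j] Dij; have := D_pos Dij => // _.
have [v h s _] := growthP x; rewrite /decode !fill_growth [i.+1.-1]/= [j.+1.-1]/= growthSS.
by have [] := fwdP F_ok (x i.+1 j.+1) (h i j) (v i j) (s i j.+1) (s i.+1 j).
Qed.

End Growth.

(** * Transfer of tableaux between two rules *)

Section Transfer.
Variables (D : nat -> nat -> bool) (N : nat).
Hypothesis D_pos : forall i j, D i j -> (0 < i) && (0 < j).
Hypothesis D_down : forall i j i' j', D i j -> 0 < i' <= i -> 0 < j' <= j -> D i' j'.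
Hypothesis D_bound : forall i j, D i j -> i + j < N.
Variables (F F' : local_rule).
Hypotheses (F_ok : rule_ok F) (F'_ok : rule_ok F').

(** The border of the [F] diagram of [x] is decoded by [F']. The value 0 outside [D] makes the
    result again a tableau extended by zero. *)
Definition transfer x i j := if D i j then decode F' D N (growth F x) i j else 0.

Lemma growth_transfer x i j : vertex D i j -> ~~ D i.+1 j.+1 ->
  growth F' (transfer x) i j = growth F x i j.
Proof.
move=> vij nDij; rewrite (@eq_growth _ _ D_down _ (decode F' D N (growth F x))) //; last first.
  by move=> a b Dab; rewrite /transfer Dab.
rewrite growth_decode //; last exact: growthP.
by rewrite fillE // ifN.
Qed.

(** The two diagrams agree on the border, and on the vertices of [D] filling depends on border
    values only. *)
Lemma transferK x i j : D i j -> decode F D N (growth F' (transfer x)) i j = x i j.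
Proof.
move=> Dij; rewrite -[RHS](decode_growth F_ok D_pos D_bound) //.
have eqf a b : vertex D a b -> fill F D (growth F' (transfer x)) N a b =
    fill F D (growth F x) N a b.
  move=> vab; apply: (eq_fill _ D_down D_bound) => //; [exact: growth_transfer|lia].
case: i j Dij => [|i] [|j] Dij; have := D_pos Dij => // _.
have [? ?] := vertex_cell D_down Dij.
by rewrite /decode !eqf // /vertex Dij !orbT.
Qed.

Lemma row_length i : exists2 n, n <= N & forall j, D i.+1 j.+1 = (j < n).
Proof.
have : exists n, ~~ D i.+1 n.+1 by exists N; apply/negP => /D_bound; lia.
move=> /ex_minnP[n nD n_min]; exists n.
  by apply: n_min; apply/negP => /D_bound; lia.
move=> j; apply/idP/idP => [Dj|jn].
  by rewrite ltnNge; apply: contra nD => nj; apply: D_down Dj _ _; lia.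
by apply/negPn/negP => /n_min; lia.
Qed.

(** The equality holds row by row. If row i+1 has n cells, its sum is the difference of the sizes at
    (i+1, n) and (i, n), two border vertices, where the diagrams agree. *)
Lemma transfer_sum x :
  \sum_(i < N) \sum_(j < N | D i.+1 j.+1) transfer x i.+1 j.+1 =
  \sum_(i < N) \sum_(j < N | D i.+1 j.+1) x i.+1 j.+1.
Proof.
apply: eq_bigr => i _; have [n nN Dn] := row_length i.
rewrite !(eq_bigl (fun j : 'I_N => j < n) _ (fun j => Dn j)).
rewrite -(big_ord_widen N (fun j => transfer x i.+1 j.+1) nN).
rewrite -(big_ord_widen N (fun j => x i.+1 j.+1) nN).
have vn : vertex D i.+1 n /\ vertex D i n.
  case: n Dn {nN} => [|n] Dn; first by split; rewrite /vertex /= ?orbT.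
  have Dni : D i.+1 n.+1 by rewrite Dn.
  by split; [rewrite /vertex Dni orbT|have [] := vertex_cell D_down Dni].
have nD k : i <= k -> ~~ D k.+1 n.+1.
  move=> ik; apply/negP => Dk; have : D i.+1 n.+1 by apply: D_down Dk _ _; lia.
  by rewrite Dn ltnn.
have := growth_row_sum F_ok x i n; have := growth_row_sum F'_ok (transfer x) i n.
by rewrite !growth_transfer ?nD ?vn.1 ?vn.2 //; lia.
Qed.

End Transfer.

(** * Passage times in growth diagrams *)

Section LastPassageRows.

(* Last passage through a row with weights a, entered with values v; entering
   in the first column with value 0 is always allowed. *)
Fixpoint pass (a v : nat -> nat) j :=
  if j is j'.+1 then maxn (pass a v j') (v j) + a j else 0.

Lemma pass_swap a b a' b' d v : d 0 = 0 ->
  (forall j, a' j.+1 = minn (a j.+1) (d j)) ->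
  (forall j, b' j.+1 = a j.+1 + b j.+1 - a' j.+1) ->
  (forall j, d j.+1 = d j + b j.+1 - a' j.+1) ->
  pass b (pass a v) = pass b' (pass a' v).
Proof.
move=> d0 a'E b'E dE; apply: funext => j.
(* The second equation is the invariant that makes the first one inductive. *)
suff [] : pass b (pass a v) j = pass b' (pass a' v) j /\
  pass a v j + d j = maxn (pass b (pass a v) j) (pass a' v j + d j) by [].
elim: j => [|j [IH1 IH2]]; first by rewrite /= d0.
by rewrite /= b'E dE a'E; move: IH1 IH2; lia.
Qed.

Lemma eq_pass a a' v : (forall j, a j.+1 = a' j.+1) -> pass a v = pass a' v.
Proof. by move=> aa'; apply: funext; elim=> //= j ->; rewrite aa'. Qed.

(** Row [i] is crossed first and row 1 last, as on a path from (i, 1) to (1, j). *)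
Fixpoint pass_rows (x : nat -> nat -> nat) i v :=
  if i is i'.+1 then pass_rows x i' (pass (x i) v) else v.

Definition line (g : nat -> part) k j := g j k.

Definition increment (g : nat -> part) k j := g j k - g j.-1 k.

Fixpoint pass_lines (g : nat -> part) k v :=
  if k is k'.+1 then pass_lines g k' (pass (increment g k') v) else v.

Local Notation burge := (growth burge_rule).
#[local] Arguments growth : simpl never.

(** Induction on the number of rows: the new row is entered first, and [pass_swap] moves it across
    the lines of the previous row, last line first. *)
Lemma pass_rowsE x i v : pass_rows x i v = pass_lines (burge x i) i v.
Proof.
elim: i v => [//|i IHi] v /=; rewrite {}IHi.
have [vt h s c0] := growthP burge_rule_ok x.
pose c k j := rise (burge x i j.-1) (burge x i j) (burge x i.+1 j.-1) i (x i.+1 j) (i - k).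
have passS k w : k <= i -> pass_lines (burge x i) k (pass (c k) w) =
    pass_lines (burge x i.+1) k (pass (increment (burge x i.+1) k) w).
  elim: k w => [|k IHk] w ki /=.
    by apply: eq_pass => j; rewrite /increment growthSS /c /= subn0 addKn.
  rewrite -IHk 1?ltnW //; congr pass_lines.
  apply: (@pass_swap _ _ _ _ (fun j => burge x i j k - burge x i.+1 j k.+1)).
  - by rewrite !growth0.
  - by move=> j; rewrite /increment growthSS /= addKn.
  - move=> j; rewrite /c riseE // /increment growthSS /= addKn.
    by move: (h i j k) (vt i j k); lia.
  - move=> j; rewrite /increment.
    have := h i j k; have := vt i j k; have := vt i j.+1 k; have := h i.+1 j k.+1.
    by rewrite [j.+1.-1]/=; lia.
rewrite -passS // /c; congr pass_lines.
by apply: eq_pass => j; rewrite subnn.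
Qed.

(** By interlacing, the value coming from line k+1 never exceeds the one running along line k, so
    each pass turns line k+1 into line k. Line [i] is zero, the initial value. *)
Lemma burge_top x i j : burge x i j 0 = pass_rows x i (fun=> 0) j.
Proof.
have [_ h s c0] := growthP burge_rule_ok x.
have passl k : pass (increment (burge x i) k) (line (burge x i) k.+1) = line (burge x i) k.
  apply: funext; elim=> [|a IHa] /=; first by rewrite /line c0.
  by rewrite IHa /line /increment; move: (h i a k); rewrite [a.+1.-1]/=; lia.
have pass_linesE k : pass_lines (burge x i) k (line (burge x i) k) = line (burge x i) 0.
  by elim: k => //= k IHk; rewrite passl.
rewrite pass_rowsE -[LHS]/(line (burge x i) 0 j) -(pass_linesE i).
by congr (pass_lines _ _ _ j); apply: funext => a; rewrite /line s.
Qed.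

Lemma rsk_top x i j : growth rsk_rule x i.+1 j.+1 0 =
  maxn (growth rsk_rule x i j.+1 0) (growth rsk_rule x i.+1 j 0) + x i.+1 j.+1.
Proof. by []. Qed.

End LastPassageRows.

(** * Lattice paths *)

Section LatticePaths.
Implicit Types (a c : nat * nat) (pi : seq (nat * nat)).

Lemma box_dist_path a pi : path (fun u v => box_dist u v == 1) a pi ->
  box_dist a (last a pi) <= size pi.
Proof.
elim: pi a => [a _|v s IHs a /= /andP[/eqP av /IHs]].
  by rewrite /box_dist /= !distnn.
by move: av; rewrite /box_dist; lia.
Qed.

(** The possible last steps of a minimal path from [a]: unit steps away from [a]. *)
Definition lattice_step a c' c :=
  box_dist c' c = 1 /\ box_dist a c = (box_dist a c').+1.

Lemma box_distxx a : box_dist a a = 0.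
Proof. by rewrite /box_dist !distnn. Qed.

Lemma lattice_path_rcons a c pi z : lattice_path a c (rcons pi z) ->
  z = c /\ if pi is [::] then a = c
           else exists2 c', lattice_path a c' pi & lattice_step a c' c.
Proof.
case: pi => [|q s] /=; first by case/and3P => /eqP -> /eqP -> _.
case/and4P => /eqP ->; rewrite rcons_path last_rcons size_rcons.
move=> /andP[ps step] /eqP zc /eqP sizes; split=> //; subst z.
have ds := box_dist_path ps; exists (last a s).
  rewrite !eqxx ps /=; move: step sizes ds; rewrite /box_dist; lia.
split; first exact/eqP.
by move: step sizes ds; rewrite /box_dist; lia.
Qed.

Lemma rcons_lattice_path a c' c pi : lattice_path a c' pi -> lattice_step a c' c ->
  lattice_path a c (rcons pi c).
Proof.
case: pi => [//|q s] /and4P[/eqP -> ps /eqP ls /eqP ss] [/eqP d1 d2] /=.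
by rewrite rcons_path ps ls d1 last_rcons size_rcons ss d2 !eqxx.
Qed.

Section Recursion.
Variables (a : nat * nat) (ok : pred (nat * nat)) (w V : nat * nat -> nat).

(** A supersolution [V] of the recursion bounds all path sums; [ok] is a region, stable under
    predecessors, where the recursion is available. *)
Lemma lattice_path_le :
  w a <= V a ->
  (forall c' c, ok c -> lattice_step a c' c -> ok c' /\ V c' + w c <= V c) ->
  forall c pi, ok c -> lattice_path a c pi -> \sum_(p <- pi) w p <= V c.
Proof.
move=> Va Vstep c pi; elim/last_ind: pi c => [//|pi z IHpi] c okc.
move=> /lattice_path_rcons[->]; rewrite -cats1 big_cat big_seq1 /=.
case: pi IHpi => [_ <-|q s IHpi [c' pc' sc']]; first by rewrite big_nil.
have [okc' /(leq_trans _)] := Vstep _ _ okc sc'; apply.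
by rewrite leq_add2r IHpi.
Qed.

(** The path is built by backtracking through predecessors that realise [V]; the distance to [a]
    drops by 1 each time. *)
Lemma lattice_path_eq :
  w a = V a ->
  (forall c, ok c -> c != a ->
     exists c', [/\ ok c', lattice_step a c' c & V c = V c' + w c]) ->
  forall c, ok c -> exists2 pi, lattice_path a c pi & \sum_(p <- pi) w p = V c.
Proof.
move=> Va Vstep c okc; move nE: (box_dist a c) => n.
elim: n c okc nE => [|n IHn] c okc nE.
  have -> : c = a.
    by move: nE; clear; case: a c => [a1 a2] [c1 c2]; rewrite /box_dist /= => ?; congr pair; lia.
  by exists [:: a]; rewrite ?big_seq1 //= box_distxx !eqxx.
have ca : c != a by apply: contra_eq_neq nE => ->; rewrite box_distxx.
have [c' [okc' sc' Vc]] := Vstep c okc ca.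
have [|pi ppi wpi] := IHn c' okc'; first by case: sc'; lia.
exists (rcons pi c); first exact: rcons_lattice_path ppi sc'.
by rewrite -cats1 big_cat big_seq1 /= wpi Vc.
Qed.

End Recursion.

Variable x : nat -> nat -> nat.
Let w (p : nat * nat) := x p.1 p.2.

Lemma rsk_top_le i j pi : 0 < i -> 0 < j -> lattice_path (1, 1) (i, j) pi ->
  \sum_(p <- pi) w p <= growth rsk_rule x i j 0.
Proof.
move=> i0 j0; pose V p := growth rsk_rule x p.1 p.2 0.
apply: (@lattice_path_le _ (fun p => (0 < p.1) && (0 < p.2)) _ V); last by apply/andP.
  by rewrite /V rsk_top /w leq_addl.
move=> [i1 j1] [[|i2] [|j2]] // _; rewrite /lattice_step /box_dist /= => st.
split; first by case: st; lia.
rewrite /V rsk_top leq_add2r leq_max.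
have [->|->] : (i1, j1) = (i2, j2.+1) \/ (i1, j1) = (i2.+1, j2).
- case: st => s1 s2; have [?|?] := eqVneq i1 i2; [left|right]; congr pair; lia.
- by rewrite leqnn.
- by rewrite leqnn orbT.
Qed.

Lemma rsk_top_eq i j : 0 < i -> 0 < j ->
  exists2 pi, lattice_path (1, 1) (i, j) pi & \sum_(p <- pi) w p = growth rsk_rule x i j 0.
Proof.
move=> i0 j0; pose V p := growth rsk_rule x p.1 p.2 0.
apply: (@lattice_path_eq _ (fun p => (0 < p.1) && (0 < p.2)) _ V); last by apply/andP.
  by rewrite /V rsk_top.
move=> [[|i1] [|j1]] // _ ne; rewrite /V rsk_top.
have [le|lt] := leqP (growth rsk_rule x i1 j1.+1 0) (growth rsk_rule x i1.+1 j1 0).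
  case: j1 ne le => [|j1] ne le; last first.
    by exists (i1.+1, j1.+1); split; rewrite ?(maxn_idPr le) // /lattice_step /box_dist /=; lia.
  (* In the first column the left neighbour is on the axis, with value 0. If it is maximal, the box
     above also has value 0 and serves as predecessor. *)
  case: i1 ne le => [//|i1] ne le.
  exists (i1.+1, 1); split=> //; first by rewrite /lattice_step /box_dist /=; lia.
  by move: le; rewrite /V /w !growth0 /=; lia.
case: i1 ne lt => [//|i1] _ lt.
exists (i1.+1, j1.+1); split; rewrite ?(maxn_idPl (ltnW lt)) //.
by rewrite /lattice_step /box_dist /=; lia.
Qed.

(** Passage times from (i, 1) once the [d] rows i, i - 1, ..., i - d + 1 are crossed; they supply
    the values at intermediate boxes. *)
Fixpoint pass_from i d : nat -> nat :=
  if d is d'.+1 then pass (x (i - d')) (pass_from i d') else fun=> 0.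

Lemma pass_from_rows i : pass_from i i = pass_rows x i (fun=> 0).
Proof.
suff all_d d : d <= i -> pass_rows x i (fun=> 0) = pass_rows x (i - d) (pass_from i d).
  by rewrite (all_d i) // subnn.
elim: d => [|d IHd] di; first by rewrite subn0.
by rewrite IHd 1?ltnW // -(subnSK di) /= subnSK.
Qed.

Lemma pass_fromSS i d j : pass_from i d.+1 j.+1 =
  maxn (pass_from i d.+1 j) (pass_from i d j.+1) + x (i - d) j.+1.
Proof. by []. Qed.

Lemma pass_from0 i d : pass_from i d 0 = 0.
Proof. by case: d. Qed.

#[local] Arguments pass_from : simpl never.

Lemma burge_top_le i j pi : 0 < i -> 0 < j -> lattice_path (i, 1) (1, j) pi ->
  \sum_(p <- pi) w p <= growth burge_rule x i j 0.
Proof.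
move=> i0 j0; rewrite burge_top -pass_from_rows.
pose V p := pass_from i (i - p.1).+1 p.2.
have -> : pass_from i i j = V (1, j) by rewrite /V -[X in pass_from _ X](prednK i0) -subn1.
apply: (@lattice_path_le _ (fun p => (0 < p.1 <= i) && (0 < p.2)) _ V).
- by rewrite /V /w /= subnn pass_fromSS subn0 leq_addl.
- move=> [i1 j1] [i2 [|j2]] //=; rewrite ?andbF // andbT => /andP[i20 i2i].
  rewrite /lattice_step /box_dist /= => st; split; first by case: st; lia.
  rewrite /V /w /= pass_fromSS subKn // leq_add2r leq_max.
  have [e|e] : i1 = i2 /\ j1 = j2 \/ i1 = i2.+1 /\ j1 = j2.+1 by case: st; lia.
    by rewrite e.1 e.2 leqnn.
  rewrite e.1 e.2 (_ : (i - i2.+1).+1 = i - i2) ?leqnn ?orbT //.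
  by case: st; lia.
- by rewrite /= i0 j0.
Qed.

Lemma burge_top_eq i j : 0 < i -> 0 < j ->
  exists2 pi, lattice_path (i, 1) (1, j) pi & \sum_(p <- pi) w p = growth burge_rule x i j 0.
Proof.
move=> i0 j0; rewrite burge_top -pass_from_rows.
pose V p := pass_from i (i - p.1).+1 p.2.
have -> : pass_from i i j = V (1, j) by rewrite /V -[X in pass_from _ X](prednK i0) -subn1.
apply: (@lattice_path_eq _ (fun p => (0 < p.1 <= i) && (0 < p.2)) _ V).
- by rewrite /V /w /= subnn pass_fromSS subn0.
- move=> [i1 [|j1]] /=; rewrite ?andbF // andbT => /andP[i10 i1i] ne.
  rewrite /V /w /= pass_fromSS subKn //.
  have [le|lt] := leqP (pass_from i (i - i1) j1.+1) (pass_from i (i - i1).+1 j1).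
    case: j1 ne le => [|j1] ne le; last first.
      exists (i1, j1.+1); split; rewrite ?(maxn_idPl le) /= ?i10 ?i1i //.
      by rewrite /lattice_step /box_dist /=; lia.
    have {ne}i1i' : i1 < i by rewrite ltn_neqAle i1i andbT; apply: contraNneq ne => ->.
    exists (i1.+1, 1); split; rewrite ?i1i' //=.
      by rewrite /lattice_step /box_dist /=; lia.
    move: le; rewrite pass_from0 leqn0 => /eqP le.
    by rewrite (_ : (i - i1.+1).+1 = i - i1) ?le ?max0n //; lia.
  have i1i' : i1 < i.
    by rewrite ltn_neqAle i1i andbT; apply: contraTneq lt => ->; rewrite subnn.
  exists (i1.+1, j1.+1); split; rewrite ?i1i' //=.
    by rewrite /lattice_step /box_dist /=; lia.
  by rewrite (_ : (i - i1.+1).+1 = i - i1) ?(maxn_idPr (ltnW lt)) //; lia.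
- by rewrite /= i0 j0.
Qed.

End LatticePaths.

Local Open Scope classical_set_scope.
Local Open Scope ring_scope.

(** * The bijection on integer tableaux of shape [la] *)

Section LppTransfer.
Context {R : realType} {la : {fset nat * nat}}.
Implicit Types (a c : nat * nat) (b : la) (m : la -> nat) (x y : la -> R).

Definition untab m i j : nat := oapp m 0%N (insub (i, j)).

Lemma untabE m b : untab m (val b).1 (val b).2 = m b.
Proof. by rewrite /untab -surjective_pairing valK. Qed.

Lemma mem_lattice_paths a c pi : lattice_path a c pi -> {subset pi <= la} ->
  exists2 t, t \in lattice_paths (la := la) a c & map val t = pi.
Proof.
move=> pi_path sub; have pi_la : map val (pmap insub pi : seq la) = pi.
  rewrite pmap_filter; last exact: insubK.
  by rewrite (eq_in_filter (a2 := predT)) ?filter_predT // => q /sub qla; rewrite /= insubT.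
have sz : size (pmap insub pi : seq la) == (box_dist a c).+1.
  rewrite -(size_map val) pi_la; case: pi pi_path {sub pi_la} => [//|q s].
  by case/and4P => _ _ _ /eqP /= ->.
by exists (Tuple sz) => //; rewrite mem_enum inE /= pi_la.
Qed.

Lemma sum_untab m (t : seq la) :
  \sum_(q <- t) (m q)%:R = (\sum_(p <- map val t) untab m p.1 p.2)%:R :> R.
Proof. by rewrite big_map natr_sum; apply: eq_bigr => q _; rewrite untabE. Qed.

Lemma lpp_natE m a c (v : nat) :
  (forall pi, lattice_path a c pi -> {subset pi <= la}) ->
  (forall pi, lattice_path a c pi -> (\sum_(p <- pi) untab m p.1 p.2 <= v)%N) ->
  (exists2 pi, lattice_path a c pi & (\sum_(p <- pi) untab m p.1 p.2)%N = v) ->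
  lpp (fun q => (m q)%:R) a c = v%:R :> R.
Proof.
move=> sub le_v [pi pi_path sum_pi]; apply/le_anti/andP; split.
  have [t] := lpp_attained (fun q => (m q)%:R : R) sub.
  by rewrite mem_enum inE => t_path ->; rewrite sum_untab ler_nat le_v.
have [t t_in tE] := mem_lattice_paths pi_path (sub _ pi_path).
by rewrite -sum_pi -tE -sum_untab lpp_ge.
Qed.

(** A path from [a] to [c] has [box_dist a c] + 1 boxes, each contributing one error [e]. *)
Lemma lpp_le x y a c (e : R) : (forall pi, lattice_path a c pi -> {subset pi <= la}) ->
  (forall q, x q <= y q + e) -> lpp x a c <= lpp y a c + e *+ (box_dist a c).+1.
Proof.
move=> sub xy; have [t t_in ->] := lpp_attained x sub.
apply: (@le_trans _ _ (\sum_(q <- t) (y q + e))); first exact: ler_sum.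
by rewrite big_split /= big_const_seq count_predT size_tuple iter_addr addr0 lerD2r lpp_ge.
Qed.

Lemma lpp_scale x a c (k : R) : (forall pi, lattice_path a c pi -> {subset pi <= la}) ->
  0 <= k -> lpp (fun q => x q * k) a c = lpp x a c * k.
Proof.
move=> sub k0; apply/le_anti/andP; split.
  have [t t_in ->] := lpp_attained (fun q => x q * k) sub.
  by rewrite -mulr_suml ler_wpM2r // lpp_ge.
have [t t_in ->] := lpp_attained x sub.
by rewrite mulr_suml; apply: lpp_ge.
Qed.

Hypothesis young_la : young la.
Let D (i j : nat) := (i, j) \in la.
Let N := (\max_(b : la) ((val b).1 + (val b).2)).+1.

Let D_pos i j : D i j -> ((0 < i) && (0 < j))%N.
Proof. by case/young_la => i0 j0 _; rewrite i0 j0. Qed.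

Let D_down i j i' j' : D i j -> (0 < i' <= i)%N -> (0 < j' <= j)%N -> D i' j'.
Proof. by case/young_la => _ _; apply. Qed.

Let D_bound i j : D i j -> (i + j < N)%N.
Proof.
move=> Dij; rewrite ltnS.
exact: (leq_bigmax_cond (F := fun b : la => ((val b).1 + (val b).2)%N) [` Dij]%fset).
Qed.

Lemma lpp_tableau_nat m b : lpp_tableau (fun q => (m q)%:R) b =
  (growth rsk_rule (untab m) (val b).1 (val b).2 0)%:R :> R.
Proof.
have := valP b; rewrite /lpp_tableau; case: (val b) => i j ijla.
have [i0 j0 _] := young_la ijla.
apply: lpp_natE => [pi||].
- exact: lattice_path_young1.
- by move=> pi; apply: rsk_top_le.
- exact: rsk_top_eq.
Qed.

Lemma dual_lpp_tableau_nat m b : dual_lpp_tableau (fun q => (m q)%:R) b =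
  (growth burge_rule (untab m) (val b).1 (val b).2 0)%:R :> R.
Proof.
have := valP b; rewrite /dual_lpp_tableau; case: (val b) => i j ijla.
have [i0 j0 _] := young_la ijla.
apply: lpp_natE => [pi||].
- exact: lattice_path_young2.
- by move=> pi; apply: burge_top_le.
- exact: burge_top_eq.
Qed.

Lemma sum_cells m :
  \sum_(b : la) m b = (\sum_(i < N) \sum_(j < N | D i.+1 j.+1) untab m i.+1 j.+1)%N.
Proof.
transitivity (\sum_(p <- la) untab m p.1 p.2)%N.
  by rewrite big_seq_fsetE /=; apply: eq_bigr => b _; rewrite untabE.
transitivity (\sum_(p <- la) \sum_(i < N) \sum_(j < N)
    (if p == (i.+1, j.+1) then untab m i.+1 j.+1 else 0))%N.
  rewrite big_seq [RHS]big_seq; apply: eq_bigr => -[i j] ijla.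
  have := D_pos ijla; have := D_bound ijla.
  case: i j ijla => [|i] [|j] // ijla ltN _.
  have iN : (i < N)%N by lia.
  have jN : (j < N)%N by lia.
  rewrite (bigD1 (Ordinal iN)) //= (bigD1 (Ordinal jN)) //= eqxx.
  rewrite big1 ?addn0 => [|j' ne]; last first.
    by rewrite ifN //; apply: contra ne => /eqP[e]; apply/eqP/val_inj; rewrite /= e.
  rewrite big1 ?addn0 // => i' ne; rewrite big1 // => j' _.
  by rewrite ifN //; apply: contra ne => /eqP[e _]; apply/eqP/val_inj; rewrite /= e.
rewrite exchange_big; apply: eq_bigr => i _ /=.
rewrite exchange_big [RHS]big_mkcond; apply: eq_bigr => j _ /=.
rewrite -big_mkcond /=; case: ifP => [Dij|nDij].
  by rewrite -big_filter filter_pred1_uniq ?fset_uniq // big_seq1.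
by rewrite big_seq_cond big1 // => p /andP[pla /eqP pE]; move: nDij; rewrite /D -pE pla.
Qed.

Let move F F' (m : {ffun la -> nat}) : {ffun la -> nat} :=
  [ffun b => transfer D N F F' (untab m) (val b).1 (val b).2].

Let untab_move F F' (m : {ffun la -> nat}) : untab (move F F' m) = transfer D N F F' (untab m).
Proof.
apply: funext => i; apply: funext => j; rewrite /untab; case: insubP => [b _ bE|nD] /=.
  by rewrite ffunE bE.
by rewrite /transfer /D (negbTE nD).
Qed.

Let moveK F F' : rule_ok F -> rule_ok F' -> cancel (move F F') (move F' F).
Proof.
move=> F_ok F'_ok m; apply/ffunP => b; rewrite ffunE untab_move -[RHS]untabE.
have Db : D (val b).1 (val b).2 by rewrite /D -surjective_pairing; exact: valP.
by rewrite {1}/transfer Db (transferK D_pos).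
Qed.

(** [f] transfers from the Burge rule to the RSK rule. A border box is a vertex that is not the near
    corner of a cell, so both diagrams carry the same largest part there. *)
Lemma lpp_bijection : exists f g : {ffun la -> nat} -> {ffun la -> nat},
  [/\ cancel f g, cancel g f, forall m : {ffun la -> nat}, \sum_b f m b = \sum_b m b &
      forall (m : {ffun la -> nat}) b, b \in border la -> lpp_tableau (fun q => (f m q)%:R) b =
        dual_lpp_tableau (fun q => (m q)%:R) b :> R].
Proof.
exists (move burge_rule rsk_rule), (move rsk_rule burge_rule); split.
- exact: moveK burge_rule_ok rsk_rule_ok.
- exact: moveK rsk_rule_ok burge_rule_ok.
- move=> m; rewrite !sum_cells untab_move.
  exact: (transfer_sum D_down D_bound burge_rule_ok rsk_rule_ok).
- move=> m b; rewrite inE => b_border.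
  rewrite lpp_tableau_nat dual_lpp_tableau_nat untab_move.
  congr (_ %:R); rewrite (growth_transfer D_down D_bound burge_rule_ok rsk_rule_ok) //.
  by rewrite /vertex /D -surjective_pairing; case: b {b_border} => /= p ->; rewrite !orbT.
Qed.

End LppTransfer.

(** * Laws of passage times *)

Section Discrete.
Context {d : measure_display} {T : measurableType d} {R : realType}.
Variables (P : probability T R) (I : finType) (E : I -> nat -> set T).
Hypothesis mE : forall i m, measurable (E i m).
Hypothesis trivE : forall i, trivIset setT (E i).

(** [E i m] stands for the event that variable [i] has integer value [m], possibly after
    rounding. *)
Definition atom (m : {ffun I -> nat}) : set T := \bigcap_i E i (m i).

Definition atoms (Q : set {ffun I -> nat}) : set T := \bigcup_(m in Q) atom m.

Lemma measurable_atom m : measurable (atom m).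
Proof. by apply: fin_bigcap_measurable. Qed.

Lemma measurable_atoms Q : measurable (atoms Q).
Proof.
rewrite /atoms bigcup_mkcond; apply: countable_bigcupT_measurable => // m.
by case: ifP => _ //; exact: measurable_atom.
Qed.

Lemma atom_inj m m' w : atom m w -> atom m' w -> m = m'.
Proof.
move=> mw m'w; apply/ffunP => i; apply: (@trivE i (m i) (m' i)) => //.
by exists w; split; [exact: mw|exact: m'w].
Qed.

Variable W : nat -> \bar R.
Hypothesis P_atom : forall m, P (atom m) = W (\sum_i m i)%N.

(** An atom's probability depends only on the sum of [m], which [f] preserves. As [Q] may be
    infinite, finite truncations by that sum are compared first, and then the limit is taken. *)
Lemma atoms_bij Q (f g : {ffun I -> nat} -> {ffun I -> nat}) :
  cancel f g -> cancel g f -> (forall m, \sum_i f m i = \sum_i m i)%N ->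
  P (atoms Q) = P (atoms (f @^-1` Q)).
Proof.
move=> fK gK sumf; pose B s := [set m : {ffun I -> nat} | (\sum_i m i <= s)%N].
have finB A s : finite_set (A `&` B s).
  apply: (@sub_finite_set _ _ ((fun h : {ffun I -> 'I_s.+1} =>
    [ffun i => h i : nat]) @` setT)); last exact: finite_image.
  move=> m [_ ms]; exists [ffun i => inord (m i)] => //.
  apply/ffunP => i; rewrite !ffunE inordK // ltnS (leq_trans _ ms) //.
  by rewrite (bigD1 i) //= leq_addr.
have PB A s : P (atoms (A `&` B s)) = \sum_(m \in A `&` B s) W (\sum_i m i)%N.
  rewrite measure_fin_bigcup //; first by apply: eq_fsbigr => m _; exact: P_atom.
    by move=> m m' _ _ [w [mw m'w]]; exact: atom_inj mw m'w.
  by move=> m _; exact: measurable_atom.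
have cvgB A : P (atoms (A `&` B s)) @[s --> \oo] --> P (atoms A).
  have -> : atoms A = \bigcup_s atoms (A `&` B s).
    apply/seteqP; split=> w.
      by move=> [m Am mw]; exists (\sum_i m i)%N => //; exists m => //; split=> //; exact: leqnn.
    by move=> [s _ [m [Am _] mw]]; exists m.
  apply: nondecreasing_cvg_mu.
  - by move=> s; exact: measurable_atoms.
  - by apply: bigcupT_measurable => s; exact: measurable_atoms.
  - move=> s s' ss'; apply/subsetPset => w [m [Am Bm] mw].
    by exists m => //; split=> //; exact: leq_trans Bm ss'.
apply: (cvg_unique (@ereal_hausdorff R) (cvgB Q)).
suff -> : (fun s => P (atoms (Q `&` B s))) = (fun s => P (atoms (f @^-1` Q `&` B s))).
  exact: cvgB.
apply: funext => s; rewrite !PB.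
rewrite (reindex_fsbig f (f @^-1` Q `&` B s)).
  by apply: eq_fsbigr => m _; rewrite sumf.
split.
- by move=> m [Qm Bm]; split=> //; rewrite /B /= sumf.
- by move=> m m' _ _ /(can_inj fK).
- move=> m [Qm Bm]; exists (g m); rewrite ?gK //; split; first by rewrite /= gK.
  by rewrite /B /= -sumf gK.
Qed.

End Discrete.

(** * Independent geometric variables *)

Section GeometricAtoms.
Context {d : measure_display} {T : measurableType d} {R : realType}.
Variables (P : probability T R) (I : finType) (E : I -> nat -> set T) (p : R).
Hypothesis p01 : 0 < p < 1.
Hypothesis mE : forall i m, measurable (E i m).
Hypothesis trivE : forall i, trivIset setT (E i).
Hypothesis P_E : forall i m, P (E i m) = (p * (1 - p) ^+ m)%:E.
Hypothesis indepE : forall m : {ffun I -> nat},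
  P (atom E m) = (\prod_i P (E i (m i)))%E.

Lemma P_geometric_atom m :
  P (atom E m) = (p ^+ #|I| * (1 - p) ^+ (\sum_i m i)%N)%:E.
Proof.
rewrite indepE (eq_bigr (fun i => (p * (1 - p) ^+ m i)%:E)) => [|i _]; last exact: P_E.
by rewrite prodEFin big_split /= prodr_const expr_sum.
Qed.

Lemma P_bigcup_geometric i : P (\bigcup_m E i m) = 1%E.
Proof.
rewrite measure_bigcup //; apply: (cvg_lim (@ereal_hausdorff R)).
have -> : (fun n => \sum_(0 <= m < n | m \in setT) P (E i m))%E =
    EFin \o series (geometric p (1 - p)).
  apply: funext => n /=; rewrite -sumEFin; apply: eq_big => [m|m _]; first by rewrite in_setT.
  exact: P_E.
apply: cvg_EFin; first by near=> n.
case/andP: p01 => p0 p1.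
have q1 : `|1 - p| < 1 by rewrite gtr0_norm ?subr_gt0 // ltrBlDr ltrDl.
by have := cvg_geometric_series (a := p) q1; rewrite subKr divff // gt_eqF.
Unshelve. all: by end_near. Qed.

(** Outside all atoms some [i] avoids every [E i m]; each of these finitely many events is null
    because the geometric weights add up to 1. *)
Lemma P_setC_atoms : P (~` atoms E setT) = 0%E.
Proof.
apply/eqP; rewrite -measure_le0.
have fin_I : finite_set [set: I] by [].
have sub : ~` atoms E setT `<=` \bigcup_(i in setT) ~` \bigcup_m E i m.
  move=> w nw; apply: contrapT => nn; apply: nw.
  have /choice[f fP] : forall i, exists m, E i m w.
    by move=> i; apply: contrapT => ni; apply: nn; exists i => // -[m _ mw]; apply: ni; exists m.
  by exists [ffun i => f i] => // i _; rewrite ffunE.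
have mU i : measurable (\bigcup_m E i m) by apply: bigcupT_measurable.
have mC i : [set: I] i -> measurable (~` \bigcup_m E i m) by move=> _; exact: measurableC.
have := content_sub_fsum P fin_I mC (measurableC (measurable_atoms mE setT)) sub.
move=> /le_trans; apply; rewrite fsbig1 // => i _.
by rewrite /= probability_setC // P_bigcup_geometric subee.
Qed.

Lemma P_setI_atoms A : measurable A -> P A = P (A `&` atoms E setT).
Proof.
move=> mA; have mU := measurable_atoms mE setT.
rewrite (measureDI P mA mU).
rewrite [X in (X + _)%E](_ : _ = 0%E) ?add0e //; apply/eqP; rewrite -measure_le0 -P_setC_atoms.
apply: le_measure; rewrite ?inE; [exact: measurableD|exact: measurableC|].
by move=> w [].
Qed.

End GeometricAtoms.

(** * Measures on tuples are determined by boxes *)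

Section Boxes.
Context {R : realType} {n : nat}.

(** Extended bounds let [+oo] leave a coordinate free. *)
Definition box (t : 'I_n -> \bar R) : set (n.-tuple R) :=
  [set x | forall i, ((tnth x i)%:E <= t i)%E].

Let boxes : set (set (n.-tuple R)) := [set box t | t in setT].

Lemma measurable_box t : measurable (box t).
Proof.
have mray (c : \bar R) : measurable [set y : R | (y%:E <= c)%E].
  case: c => [c||].
  - rewrite (_ : [set y | _] = `]-oo, c]%classic) //; exact: measurable_itv.
  - by rewrite (_ : [set y | _] = setT) //; apply/seteqP; split=> y //= _; rewrite leey.
  - by rewrite (_ : [set y | _] = set0) //; apply/seteqP; split=> y.
have -> : box t = \bigcap_i ((@tnth n R ^~ i) @^-1` [set y : R | (y%:E <= t i)%E]).
  by apply/seteqP; split=> x bx i; [move=> _; exact: bx|exact: bx].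
apply: fin_bigcap_measurable => // i _; rewrite -[X in measurable X]setTI.
exact: measurable_tnth.
Qed.

Lemma measurable_boxes (A : set (n.-tuple R)) : measurable A -> <<s boxes >> A.
Proof.
apply: smallest_sub; first exact: smallest_sigma_algebra.
move=> B; rewrite /= -bigcup_seq => -[i _ [C mC <-]]; rewrite setTI.
pose H : set (set R) := [set C | <<s boxes >> ((@tnth n R ^~ i) @^-1` C)].
have {}mC : <<s @RGenOInfty.G R >> C.
  exact: (eq_ind _ (fun M => M C) mC _ (RGenOInfty.measurableE R)).
have [b0 bD bU] := smallest_sigma_algebra setT boxes.
apply: (smallest_sub (X := H)) mC; first by split=> [|X /bD|F /bU].
move=> _ [r ->]; rewrite /H /=.
(* The preimage of an open ray is the complement of a box bounded in coordinate [i] only. *)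
rewrite (_ : _ @^-1` _ = setT `\` box (fun j => if j == i then r%:E else +oo%E)).
  by apply: bD; apply: sub_sigma_algebra; eexists.
apply/seteqP; split=> x /=; rewrite in_itv /= andbT.
  by move=> rx; split=> // /(_ i); rewrite eqxx lee_fin leNgt rx.
move=> [_ nb]; rewrite ltNge; apply/negP => xr; apply: nb => j.
by case: eqP => [->|_]; rewrite ?lee_fin ?leey.
Qed.

(** Boxes generate the sigma-algebra and are stable under intersection, by coordinatewise minima;
    the whole space is a box of finite measure. *)
Lemma measure_tuple_unique (m1 m2 : {measure set (n.-tuple R) -> \bar R}) :
  (m1 setT < +oo)%E -> (forall t, m1 (box t) = m2 (box t)) ->
  forall A, measurable A -> m1 A = m2 A.
Proof.
move=> m1_fin m12 A /measurable_boxes; pose g (k : nat) : set (n.-tuple R) := setT.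
apply: (@g_sigma_algebra_measure_unique _ _ _ boxes _ g).
- by move=> _ [t _ <-]; exact: measurable_box.
- by move=> k; exists (fun=> +oo%E) => //; apply/seteqP; split=> x // _ i; rewrite leey.
- by apply/seteqP; split=> x // _; exists 0%N.
- move=> _ _ [s _ <-] [t _ <-]; exists (fun i => Order.min (s i) (t i)) => //.
  apply/seteqP; split=> x; first by move=> st; split=> i; have := st i; rewrite le_min => /andP[].
  by move=> [xs xt] i; rewrite le_min xs xt.
- by move=> _ [t _ <-].
- by [].
Qed.

End Boxes.

Lemma independent_atom (R : realType) (d : measure_display) (T : measurableType d)
    (P : probability T R) (I : finType) (Z : I -> {RV P >-> R}) (B : I -> nat -> set R)
    (m : {ffun I -> nat}) :
  (forall i k, measurable (B i k)) -> mutually_independent Z ->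
  P (atom (fun i k => Z i @^-1` B i k) m) = (\prod_i P (Z i @^-1` B i (m i)))%E.
Proof.
move=> mB Z_indep.
rewrite [RHS](eq_bigl (fun i => i \in [set: I]%SET)) => [|i]; last by rewrite finset.in_setT.
rewrite -(Z_indep [set: I]%SET (fun i => B i (m i))) //.
have -> // : [set` [set: I]%SET] = [set: I].
by apply/seteqP; split=> i //= _; rewrite finset.in_setT.
Qed.

(** * Joint laws of passage times of random tableaux *)

Section Laws.
Context {R : realType} {d : measure_display} {T : measurableType d}.
Variables (P : probability T R) (la : {fset nat * nat}) (X : la -> {RV P >-> R}).
Hypothesis young_la : young la.

Lemma measurable_lpp a c : measurable_fun setT (fun w => lpp (fun q => X q w) a c).
Proof.
rewrite /lpp /path_weights; case: (lattice_paths a c) => [|p s].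
  by under eq_fun do rewrite big_nil; exact: measurable_cst.
pose F (t : (box_dist a c).+1.-tuple la) w := \sum_(q <- t) X q w.
have mF t : measurable_fun setT (F t) by apply: measurable_sum => q.
rewrite (_ : (fun w => _) = fun w => \big[Num.max/F p w]_(t <- p :: s) F t w); last first.
  by apply: funext => w; rewrite big_map.
elim: (p :: s) => [|t s' IHs]; first by under eq_fun do rewrite big_nil; exact: mF.
under eq_fun do rewrite big_cons.
exact: measurable_maxr (mF t) IHs.
Qed.

Lemma measurable_joint (S : {set la}) (Y : la -> T -> R) :
  (forall b, measurable_fun setT (Y b)) -> measurable_fun setT (joint S Y).
Proof.
move=> mY; apply/measurable_fun_tnthP => i.
rewrite (_ : _ \o _ = Y (enum_val i)); first exact: mY.
by apply: funext => w /=; rewrite tnth_mktuple.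
Qed.

Variables (S : {set la}) (S_border : S \subset border la).

Let J (Y : (la -> R) -> la -> R) (x : la -> R) : #|S|.-tuple R :=
  [tuple Y x (enum_val i) | i < #|S|].

Let nat_tab (m : {ffun la -> nat}) q : R := (m q)%:R.

(** Common to geometric entries and to rounded exponential ones: the bijection pulls the event on
    ordinary passage times back to the one on dual passage times. *)
Lemma atoms_lpp (E : la -> nat -> set T) (W : nat -> \bar R) (A : set (#|S|.-tuple R)) :
  (forall i m, measurable (E i m)) -> (forall i, trivIset setT (E i)) ->
  (forall m : {ffun la -> nat}, P (atom E m) = W (\sum_i m i)%N) ->
  P (atoms E [set m | A (J lpp_tableau (nat_tab m))]) =
  P (atoms E [set m | A (J dual_lpp_tableau (nat_tab m))]).
Proof.
move=> mE tE PE; have [f [g [fK gK sumf lpp_f]]] := lpp_bijection (R := R) young_la.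
rewrite (atoms_bij mE tE PE _ fK gK sumf); congr (P (atoms E _)).
have Jf m : J lpp_tableau (nat_tab (f m)) = J dual_lpp_tableau (nat_tab m).
  apply: eq_from_tnth => i; rewrite !tnth_mktuple; apply: lpp_f.
  exact: (fintype.subsetP S_border _ (enum_valP i)).
by apply/seteqP; split=> m /=; rewrite Jf.
Qed.

Section Geometric.
Variable p : R.
Hypothesis p01 : 0 < p < 1.
Hypothesis X_indep : mutually_independent X.
Hypothesis X_geom : forall b, geometric_law p (X b).

Let E b m := X b @^-1` [set m%:R : R].

Let mE b m : measurable (E b m).
Proof. by rewrite /E -[X in measurable X]setTI; exact: measurable_funP. Qed.

Let tE b : trivIset setT (E b).
Proof.
by move=> m m' _ _ [w []]; rewrite /E /= => -> /eqP; rewrite eqr_nat => /eqP.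
Qed.

Lemma geometric_same_law : same_joint_law P S
  (fun b w => lpp_tableau (fun q => X q w) b)
  (fun b w => dual_lpp_tableau (fun q => X q w) b).
Proof.
move=> A mA.
have indE m : P (atom E m) = (\prod_b P (E b (m b)))%E.
  by apply: (independent_atom (B := fun _ k => [set k%:R])).
have PX b m : P (E b m) = (p * (1 - p) ^+ m)%:E by exact: X_geom.
pose W s := (p ^+ #|{: la}| * (1 - p) ^+ s)%:E.
have PE m : P (atom E m) = W (\sum_b m b)%N by exact: P_geometric_atom PX indE m.
(* Up to a null set the sample space is the union of the atoms, and on the atom of [m] the random
   tableau equals [m]. *)
have jointE Y : (forall b, measurable_fun setT (fun w => Y (fun q => X q w) b)) ->
    pushforward P (joint S (fun b w => Y (fun q => X q w) b)) A =
    P (atoms E [set m | A (J Y (nat_tab m))]).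
  move=> mY; rewrite /pushforward (P_setI_atoms p01 mE tE PX); last first.
    by rewrite -[X in measurable X]setTI; exact: measurable_joint.
  congr (P _).
  have JE m w : atom E m w -> joint S (fun b w => Y (fun q => X q w) b) w = J Y (nat_tab m).
    move=> mw; apply: eq_from_tnth => i; rewrite !tnth_mktuple; congr (Y _ _).
    by apply: funext => q; exact: (mw q Logic.I).
  apply/seteqP; split=> w.
    by move=> [Aw [m _ mw]]; exists m => //=; rewrite -(JE m w).
  by move=> [m /= Am mw]; split; [rewrite /= (JE m w)|exists m].
rewrite !jointE => [|b|b]; [|exact: measurable_lpp..].
exact: atoms_lpp mE tE PE.
Qed.

End Geometric.

(** * Exponential entries, by discretisation *)

Section Exponential.
Variable alpha : R.
Hypothesis alpha0 : 0 < alpha.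
Hypothesis X_indep : mutually_independent X.
Hypothesis X_exp : forall b, exponential_law alpha (X b).

Let mX b (B : set R) : measurable B -> measurable (X b @^-1` B).
Proof. by move=> mB; rewrite -[X in measurable X]setTI; exact: measurable_funP. Qed.

Let P_itv0c b (u : R) : 0 <= u -> P (X b @^-1` `[0, u]) = (1 - expR (- alpha * u))%:E.
Proof.
move=> u0; rewrite -[LHS]/(distribution P (X b) `[0, u]%classic) X_exp //.
case: ltgtP u0 => // [u0 _|<- _]; first by rewrite exponential_prob_itv0c.
by rewrite mulr0 expR0 subrr set_itv1 /exponential_prob integral_set1.
Qed.

Let P_itvoc b (u v : R) : 0 <= u <= v ->
  P (X b @^-1` `]u, v]) = (expR (- alpha * u) - expR (- alpha * v))%:E.
Proof.
move=> /andP[u0 uv]; have v0 := le_trans u0 uv.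
pose B s := X b @^-1` `[0, s].
have mB s : measurable (B s) by exact: mX.
have -> : X b @^-1` `]u, v] = B v `\` B u.
  apply/seteqP; split=> w; rewrite /B /= !in_itv /=.
    move=> /andP[uX Xv]; split; first by rewrite Xv (le_trans u0) ?ltW.
    by move=> /andP[_]; rewrite leNgt uX.
  by move=> [/andP[X0 ->] /negP]; rewrite X0 /= -ltNge andbT.
have -> : P (B v `\` B u) = (P (B v) - P (B v `&` B u))%E.
  by apply: measureD => //; rewrite -ge0_fin_numE ?fin_num_measure.
have -> : B v `&` B u = B u.
  apply/seteqP; split=> w /=; rewrite /B /= !in_itv /=; first by case.
  by move=> /andP[X0 Xu]; rewrite X0 Xu (le_trans Xu).
by rewrite !P_itv0c // -EFinB; congr EFin; lra.
Qed.

Let k (n : nat) : R := n.+1%:R^-1.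

Let k_gt0 n : 0 < k n.
Proof. by rewrite invr_gt0. Qed.

(* Rounding exponential variables to multiples of [k n] makes them geometric. *)
Let cell n m : set R := `]m%:R * k n, m.+1%:R * k n]%classic.

Let E n b m := X b @^-1` cell n m.

Let mE n b m : measurable (E n b m).
Proof. by apply: mX; exact: measurable_itv. Qed.

Let tE n b : trivIset setT (E n b).
Proof.
move=> m m' _ _ [w []]; rewrite /E /cell /= !in_itv /= => /andP[mX1 Xm1] /andP[mX2 Xm2].
have := lt_le_trans mX1 Xm2; have := lt_le_trans mX2 Xm1.
by rewrite !ltr_pM2r // !ltr_nat; lia.
Qed.

Let p n := 1 - expR (- alpha * k n).

Let p01 n : 0 < p n < 1.
Proof. by rewrite subr_gt0 expR_lt1 mulNr oppr_lt0 mulr_gt0 //= ltrBlDr ltrDl expR_gt0. Qed.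

Let PE n b m : P (E n b m) = (p n * (1 - p n) ^+ m)%:E.
Proof.
have expE j : expR (- alpha * (j%:R * k n)) = expR (- alpha * k n) ^+ j.
  by rewrite mulrCA expRM_natl.
rewrite /E P_itvoc; last by rewrite ler_pM2r // ler_nat leqnSn mulr_ge0 // ltW.
by rewrite !expE /p subKr exprS mulrBl mul1r.
Qed.

Let indE n m : P (atom (E n) m) = (\prod_b P (E n b (m b)))%E.
Proof. by apply: (independent_atom (B := fun _ => cell n)) => // b j; exact: measurable_itv. Qed.

Let W n s := (p n ^+ #|{: la}| * (1 - p n) ^+ s)%:E.

Let P_atom n m : P (atom (E n) m) = W n (\sum_b m b)%N.
Proof. exact: P_geometric_atom (PE n) (indE n) m. Qed.

(** Arbitrary endpoints let one inequality be used in both directions. *)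
Let tableau (a c : la -> nat * nat) (x : la -> R) b := lpp x (a b) (c b).

Let J_tab a c w := J (tableau a c) (fun q => X q w).

Let mJ_tab a c : measurable_fun setT (J_tab a c).
Proof.
apply: (measurable_joint (S := S) (Y := fun b w => tableau a c (fun q => X q w) b)) => b.
exact: measurable_lpp.
Qed.

(** On an atom of mesh [k n], the rounded tableau lies below the true one by at most [k n] per
    entry. Rounding keeps the first event inside its integer version, [le_atoms] passes to the other
    endpoints, and undoing the rounding enlarges the bounds [t] by [k n] times the path length. *)
Lemma exponential_box_le (a c a' c' : la -> nat * nat) (t : 'I_#|S| -> \bar R) :
  (forall b pi, lattice_path (a b) (c b) pi -> {subset pi <= la}) ->
  (forall b pi, lattice_path (a' b) (c' b) pi -> {subset pi <= la}) ->
  (forall n A, P (atoms (E n) [set m | A (J (tableau a c) (nat_tab m))]) <=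
               P (atoms (E n) [set m | A (J (tableau a' c') (nat_tab m))]))%E ->
  (P (J_tab a c @^-1` box t) <= P (J_tab a' c' @^-1` box t))%E.
Proof.
move=> sub sub' le_atoms.
pose C (i : 'I_#|S|) : nat := (box_dist (a' (enum_val i)) (c' (enum_val i))).+1.
pose t' n i := (t i + (k n *+ C i)%:E)%E.
have mJ a1 c1 s : measurable (J_tab a1 c1 @^-1` box s).
  by rewrite -[X in measurable X]setTI; apply: mJ_tab => //; exact: measurable_box.
have scaled a1 c1 b m n : (forall pi, lattice_path (a1 b) (c1 b) pi -> {subset pi <= la}) ->
    tableau a1 c1 (fun q => nat_tab m q * k n) b = tableau a1 c1 (nat_tab m) b * k n.
  by move=> sub1; apply: lpp_scale => //; exact: ltW.
have step n : (P (J_tab a c @^-1` box t) <= P (J_tab a' c' @^-1` box (t' n)))%E.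
  pose A : set (#|S|.-tuple R) := [set y | forall i, ((tnth y i * k n)%:E <= t i)%E].
  rewrite (P_setI_atoms (p01 n) (mE n) (@tE n) (PE n)) //.
  have : (P (J_tab a c @^-1` box t `&` atoms (E n) setT) <=
      P (atoms (E n) [set m | A (J (tableau a c) (nat_tab m))]))%E.
    apply: le_measure; rewrite ?inE.
    - by apply: measurableI => //; exact: measurable_atoms.
    - exact: measurable_atoms.
    move=> w [Xt [m _ mw]]; exists m => //= i; apply: le_trans (Xt i).
    rewrite !tnth_mktuple lee_fin -(scaled _ _ _ _ _ (sub _)).
    have := @lpp_le _ _ (fun q => nat_tab m q * k n) (fun q => X q w) _ _ 0 (sub (enum_val i)).
    rewrite mul0rn addr0; apply => q; rewrite addr0.
    by have := mw q Logic.I; rewrite /E /cell /= in_itv /= => /andP[/ltW].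
  move=> /le_trans; apply; apply: le_trans (le_atoms n A) _.
  apply: le_measure; rewrite ?inE; [exact: measurable_atoms|exact: mJ|].
  move=> w [m /= Am mw] i; rewrite tnth_mktuple /t'.
  apply: (@le_trans _ _ ((tableau a' c' (nat_tab m) (enum_val i) * k n)%:E + (k n *+ C i)%:E)%E).
    rewrite -(scaled _ _ _ _ _ (sub' _)) -EFinD lee_fin; apply: lpp_le => [|q]; first exact: sub'.
    have := mw q Logic.I; rewrite /E /cell /= in_itv /= => /andP[_].
    by rewrite -natr1 mulrDl mul1r.
  by apply: leeD => //; have := Am i; rewrite tnth_mktuple.
have box_bigcap : box t = \bigcap_n box (t' n).
  apply/seteqP; split=> y.
    move=> yt n _ i; apply: le_trans (yt i) _.
    by rewrite /t' leeDl // lee_fin mulrn_wge0 // ltW.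
  move=> yt i; apply/lee_addgt0Pr => e e0.
  (* With this [n], [n.+1] exceeds [C i / e], so the enlargement [k n *+ C i] is at most [e]. *)
  pose n := Num.truncn ((C i)%:R / e).
  apply: le_trans (yt n Logic.I i) _; rewrite /t' leeD2l // lee_fin.
  rewrite -mulr_natl /k ler_pdivrMr // mulrC -ler_pdivrMr //.
  by apply/ltW; rewrite truncnS_gt.
have J'E : J_tab a' c' @^-1` box t = \bigcap_n (J_tab a' c' @^-1` box (t' n)).
  by rewrite {1}box_bigcap preimage_bigcap.
rewrite [in leRHS]J'E.
(* The boxes [t' n] decrease to [box t]: continuity from above. *)
apply: (cvge_to_ge (a := \oo) (f := fun n => P (J_tab a' c' @^-1` box (t' n)))); last first.
  by apply: nearW.
apply: nonincreasing_cvg_mu => //.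
- by rewrite -ge0_fin_numE ?fin_num_measure.
- exact: bigcapT_measurable.
- move=> n n' nn'; apply/subsetPset => w wt i; apply: le_trans (wt i) _.
  rewrite /t' leeD2l // lee_fin lerMn2r; apply/orP; right.
  by rewrite lef_pV2 ?posrE // ler_nat.
Qed.

Lemma exponential_same_law : same_joint_law P S
  (fun b w => lpp_tableau (fun q => X q w) b)
  (fun b w => dual_lpp_tableau (fun q => X q w) b).
Proof.
pose a1 (b : la) := (1%N, 1%N); pose c1 (b : la) := val b.
pose a2 (b : la) := ((val b).1, 1%N); pose c2 (b : la) := (1%N, (val b).2).
have sub1 b pi : lattice_path (a1 b) (c1 b) pi -> {subset pi <= la}.
  have := valP b; rewrite /a1 /c1; case: (val b) => i j ijla.
  exact: lattice_path_young1.
have sub2 b pi : lattice_path (a2 b) (c2 b) pi -> {subset pi <= la}.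
  have := valP b; rewrite /a2 /c2; case: (val b) => i j ijla.
  exact: lattice_path_young2.
have boxE t : P (J_tab a1 c1 @^-1` box t) = P (J_tab a2 c2 @^-1` box t).
  by apply/le_anti/andP; split; apply: exponential_box_le => // n A;
    rewrite (atoms_lpp A (mE n) (@tE n) (P_atom n)).
pose m1 := measure_function_pushforward__canonical__measure_function_Measure P (mJ_tab a1 c1).
pose m2 := measure_function_pushforward__canonical__measure_function_Measure P (mJ_tab a2 c2).
move=> A mA; apply: (measure_tuple_unique (m1 := m1) (m2 := m2)) mA => //.
by rewrite /m1 /= /pushforward preimage_setT probability_setT ltry.
Qed.

End Exponential.
End Laws.

(** If (i+1, j+1) were in [la], it would survive the removal of (i, j), and the remaining Young
    diagram would have to contain (i, j). *)
Lemma corner_border (la : {fset nat * nat}) : young la ->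
  corners la \subset border la.
Proof.
move=> young_la; apply/fintype.subsetP => b; rewrite !inE => young_b.
apply/negP => in_la.
have next_in : ((val b).1.+1, (val b).2.+1) \in (la `\ val b)%fset.
  rewrite !inE in_la andbT; apply/eqP => /(congr1 fst) /= /eqP.
  by rewrite -[X in _ == X]addn0 -addn1 eqn_add2l.
have [_ _ /(_ (val b).1 (val b).2)] := young_b _ _ next_in.
have [] := young_la (val b).1 (val b).2; first by rewrite -surjective_pairing; exact: valP.
move=> i0 j0 _; rewrite i0 j0 !leqnSn -surjective_pairing !inE eqxx.
by move=> /(_ isT isT).
Qed.

Theorem theorem6 (R : realType) (d : measure_display) (T : measurableType d)
    (P : probability T R) (la : {fset nat * nat}) (X : la -> {RV P >-> R})
    (young_la : young la)
    (X_indep : mutually_independent X)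
    (X_law :
      (exists p : R, 0 < p < 1 /\ forall b, geometric_law p (X b)) \/
      (exists alpha : R, 0 < alpha /\ forall b, exponential_law alpha (X b))) :
  let L b w := lpp_tableau (fun q => X q w) b in
  let L' b w := dual_lpp_tableau (fun q => X q w) b in
  same_joint_law P (border la) L L' /\ same_joint_law P (corners la) L L'.
Proof.
move=> L L'; have same (S : {set la}) : S \subset border la -> same_joint_law P S L L'.
  case: X_law => [[p [p01 X_geom]]|[alpha [alpha0 X_exp]]] S_border.
  - exact: (geometric_same_law young_la S_border p01 X_indep X_geom).
  - exact: (exponential_same_law young_la S_border alpha0 X_indep X_exp).
by split; apply: same; [exact: fintype.subxx|exact: corner_border].
Qed.
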